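(* Let $X$ be an Eberlein-Grothendieck space, i.e. a topological space homeomorphic to a subspace of $C_p(K)$ for some compact Hausdorff space $K$. If $X$ is locally countable and scattered and has cardinality $\omega_1$, then $X$ is $\sigma$-discrete.
   Context: $C_p(K)$ is the set of all continuous functions $K\to\mathbb{R}$ with the topology of pointwise convergence (inherited from $\mathbb{R}^K$). A space is locally countable if every point has a countable neighbourhood. A space is scattered if every nonempty subspace of it has an isolated point. A space is $\sigma$-discrete if it is the union of countably many subspaces each of which is discrete in its relative topology. *)

(* Defs.v *)
From HB Require Import structures.
From mathcomp Require Import all_boot all_order all_algebra.
From mathcomp Require Import all_classical all_reals all_analysis wochoice.

Set Implicit Arguments.
Unset Strict Implicit.
Unset Printing Implicit Defensive.

Import numFieldNormedType.Exports.

Local Open Scope classical_set_scope.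

Definition homeomorphic (X Y : topologicalType) : Prop :=
  exists (f : X -> Y) (g : Y -> X),
    [/\ cancel f g, cancel g f, continuous f & continuous g].

Definition continuous_functions (R : realType) (K : topologicalType) :
    set {ptws K -> R} :=
  [set f | continuous (f : K -> R)].

(* The library topologizes [set_type A] as a subspace of the ambient space, so
   this is the set of continuous functions with the topology inherited from the
   product topology of [{ptws K -> R}]. *)
Definition Cp (R : realType) (K : topologicalType) : topologicalType :=
  set_type (@continuous_functions R K).

Definition eberlein_grothendieck (R : realType) (X : topologicalType) : Prop :=
  exists K : topologicalType,
    [/\ compact [set: K], hausdorff_space K &
        exists A : set (Cp R K), homeomorphic X (set_type A)].

Definition locally_countable (X : topologicalType) : Prop :=
  forall x : X, exists2 U : set X, nbhs x U & countable U.

Definition scattered (X : topologicalType) : Prop :=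
  forall A : set X, A !=set0 -> exists x : X, isolated A x.

Definition discrete_subspace (X : topologicalType) (D : set X) : Prop :=
  forall U : set (set_type D), open U.

Definition sigma_discrete (X : topologicalType) : Prop :=
  exists D : nat -> set X,
    \bigcup_n D n = [set: X] /\ forall n, discrete_subspace (D n).

(* [(W, le)] has the order type of the first uncountable ordinal: it is an
   uncountable well-order all of whose initial segments are countable.  The
   library's [well_order] (unique least elements of nonempty subsets) makes
   [le] a reflexive total order. *)
Definition is_omega1 (W : eqType) (le : rel W) : Prop :=
  [/\ well_order le, ~ countable [set: W] &
      forall w : W, countable [set v : W | le v w]].

Definition has_cardinality_omega1 (T : Type) : Prop :=
  exists (W : eqType) (le : rel W), is_omega1 le /\ ([set: T] #= [set: W])%card.

(* Main.v *)
(* Let phi embed X in C_p(K).  For a finite list s of points of X and m > 0,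
   the codes [floor(m * phi y t) | y in s], t in K, form a finite set of integer
   vectors.  Call A stable if it contains a fixed countable neighbourhood of each
   of its points and, for every nonempty list s from A, all those classes of
   points x with a prescribed set of codes of x :: s that are countable.  Only
   countably many points are forced by each s, so countable sets have countable
   stable hulls.

   Stable sets are clearly open; they are also closed.  If x is a pointwise limit
   of A, then a finite s from A approximates x within d at any two points of K
   simultaneously, by compactness of K * K; hence two points of K with the same
   code for s have nearby values under x, so the class of x is contained in a
   small uniform ball around x, which is countable; thus x belongs to A.

   Along an enumeration of X of type omega_1, the hulls of the initial segments
   exhaust X by an increasing chain of countable clopen sets all of whose
   subunions are clopen too; the successive differences are disjoint, countable
   and open, and choosing the n-th point of each gives a discrete set. *)

Require Import Defs.
From mathcomp Require Import all_boot all_order all_algebra.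
From mathcomp Require Import all_classical all_reals all_analysis wochoice.
From mathcomp Require Import zify lra.

Set Implicit Arguments.
Unset Strict Implicit.
Unset Printing Implicit Defensive.

Import Order.TTheory GRing.Theory Num.Theory.
Import numFieldNormedType.Exports.

Local Open Scope classical_set_scope.
Local Open Scope ring_scope.

(** * Closing sets under an operation on finite lists *)

Lemma countable_seqs (T : eqType) (A : set T) :
  countable A -> countable [set s : seq T | forall x, x \in s -> A x].
Proof.
move=> /countable_injP[f finj].
have fsinj : {in [set s : seq T | forall x, x \in s -> A x] &,
    injective (map f)}.
  move=> s t; rewrite !inE /= => + + est; elim: s t est => [|x s IH] [|y t] //=.
  case=> fxy est As At; congr (_ :: _).
    by apply: finj => //; rewrite inE; [apply: As|apply: At]; rewrite mem_head.
  by apply: IH => // z zs; [apply: As|apply: At]; rewrite in_cons zs orbT.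
apply/countable_injP; exists (choice.pickle \o map f) => s t As At /=.
by move=> /(pcan_inj choice.pickleK); exact: fsinj.
Qed.

Section Hull.
Context (T : eqType) (Phi : seq T -> set T).

(* The nonempty lists [x :: s] only, so that an empty union is stable. *)
Definition stable (A : set T) :=
  forall x s, A x -> (forall y, y \in s -> A y) -> Phi (x :: s) `<=` A.

Definition hull_step (A : set T) : set T :=
  A `|` \bigcup_(s in [set s | forall y, y \in s -> A y]) Phi s.

Definition hull (A : set T) : set T := \bigcup_n iter n hull_step A.

Lemma sub_hull A : A `<=` hull A.
Proof. by move=> x Ax; exists 0%N. Qed.

Lemma iter_hull_step_le A m n :
  (m <= n)%N -> iter m hull_step A `<=` iter n hull_step A.
Proof.
move=> /subnK <-; elim: (n - m)%N => // k IH x /IH.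
by rewrite addSn iterS; left.
Qed.

Lemma hull_mono A B : A `<=` B -> hull A `<=` hull B.
Proof.
move=> AB x [n _ Ax]; exists n => //; elim: n x Ax => [|n IH] x /=; first exact: AB.
by case=> [/IH|[s As sx]]; [left|right; exists s => // y /As /IH].
Qed.

(** The iterates increase, so a finite list from the hull lies in one of them, and the next iterate
    absorbs its image. *)
Lemma stable_hull A : stable (hull A).
Proof.
move=> x s Ax As.
have {Ax As} : forall y, y \in x :: s -> hull A y.
  by move=> y; rewrite in_cons => /predU1P[-> //|/As].
move: (x :: s) => {x}s As.
have [n An] : exists n, forall y, y \in s -> iter n hull_step A y.
  elim: s As => [|x s IH] As; first by exists 0%N.
  have [|n sn] := IH; first by move=> y ys; apply: As; rewrite in_cons ys orbT.
  have [m _ xm] := As x (mem_head _ _).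
  exists (maxn m n) => y; rewrite in_cons => /predU1P[->|/sn].
    exact: (iter_hull_step_le (leq_maxl m n)).
  exact: (iter_hull_step_le (leq_maxr m n)).
by move=> y sy; exists n.+1 => //=; right; exists s.
Qed.

Lemma countable_hull A :
  (forall s, countable (Phi s)) -> countable A -> countable (hull A).
Proof.
move=> cPhi cA; apply: bigcup_countable => // n _.
elim: n => //= n IH; rewrite /hull_step -bigcup2E; apply: bigcup_countable => //.
move=> [|[|?]] _ //=; apply: bigcup_countable => //; exact: countable_seqs.
Qed.

(** A finite list from the union of a chain lies in a single member; the head [x] provides the
    member to start from. *)
Lemma stable_bigcup_chain (I : Type) (D : set I) (F : I -> set T) :
  (forall i j, D i -> D j -> F i `<=` F j \/ F j `<=` F i) ->
  (forall i, D i -> stable (F i)) -> stable (\bigcup_(i in D) F i).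
Proof.
move=> chF sF x s [i Di Fix] Fs.
have [j [Dj Fjx Fjs]] :
    exists j, [/\ D j, F j x & forall y, y \in s -> F j y].
  elim: s Fs => [|z s IH] Fs; first by exists i.
  have [|j [Dj Fjx Fjs]] := IH.
    by move=> y ys; apply: Fs; rewrite in_cons ys orbT.
  have [k Dk Fkz] := Fs z (mem_head _ _).
  have [kj|jk] := chF _ _ Dk Dj.
    exists j; split => // y; rewrite in_cons => /predU1P[->|/Fjs //].
    exact: kj.
  exists k; split => //; first exact: jk.
  by move=> y; rewrite in_cons => /predU1P[-> //|/Fjs/jk].
by move=> y /(sF j Dj x s Fjx Fjs) Fjy; exists j.
Qed.

End Hull.

(** * Splitting the space along a chain of clopen hulls *)

Lemma discrete_subspace_isolated (X : topologicalType) (D : set X) :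
  (forall x, D x -> exists2 N, open N & N x /\ forall y, N y -> D y -> y = x) ->
  discrete_subspace D.
Proof.
move=> isoD U.
exists (\bigcup_(N in [set N | open N /\
  exists x : set_type D, [/\ U x, N (val x) & forall y, N y -> D y -> y = val x]]) N).
  by apply: bigcup_open => N [].
apply/seteqP; split=> [y [N [_ [x [Ux Nx Nuniq]]] Ny]|y Uy].
  suff -> : y = x by [].
  by apply/val_inj/Nuniq => //; exact: set_valP.
have [N oN [Ny Nuniq]] := isoD (val y) (set_valP y).
by exists N => //; split => //; exists y.
Qed.

Lemma well_order_min (W : eqType) (le : rel W) (P : set W) :
  well_order le -> P !=set0 -> exists2 w, P w & forall v, P v -> le w v.
Proof.
move=> wole [w0 Pw0].
have [|w [[Pw wmin] _]] := wole [pred w | `[< P w >]].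
  by exists w0; apply/asboolP.
exists w; first exact/asboolP.
by move=> v Pv; apply/wmin/asboolP.
Qed.

Lemma sigma_discrete_clopen_stable (X : topologicalType) (Phi : seq X -> set X) :
  (forall s, countable (Phi s)) ->
  (forall A, stable Phi A -> open A /\ closed A) ->
  has_cardinality_omega1 X -> sigma_discrete X.
Proof.
move=> cPhi clopenA [W [le [[wole _ cle] /card_bijP[g /bij_inj ginj]]]].
pose f (x : X) : W := set_val (g (to_setT x)).
have finj : injective f.
  by move=> x y /val_inj/ginj/(congr1 (@set_val _ _)).
have letot v w : le v w \/ le w v.
  have [|u [->|->] umin] := @well_order_min _ _ [set v; w] wole.
  - by exists v; left.
  - by left; apply: umin; right.
  - by right; apply: umin; left.
have leanti : antisymmetric le.
  have wochain : wo_chain le predT by move=> P _; exact: wole.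
  by move=> v w; apply: (wo_chain_antisymmetric wochain).
have letrans : transitive le.
  (* Compare with the least of the three points: if it is [v] or [w], antisymmetry identifies two of
     them. *)
  move=> v u w uv vw.
  have [|z [[->|->]|->] zmin] := @well_order_min _ _ [set u; v; w] wole.
  - by exists u; left; left.
  - by apply: zmin; right.
  - by rewrite (leanti u v) // uv zmin //; left; left.
  - by rewrite -(leanti v w) // vw zmin //; left; right.
pose A w := hull Phi [set x | le (f x) w].
have Amono v w : le v w -> A v `<=` A w.
  by move=> vw; apply: hull_mono => x /= fxv; exact: letrans vw.
have cA w : countable (A w).
  apply: countable_hull => //.
  have /countable_injP[h hinj] := cle w.
  apply/countable_injP; exists (h \o f) => x y; rewrite !inE /= => xw yw exy.
  by apply: finj; apply: hinj; rewrite ?inE.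
have sA w : stable Phi (A w) by exact: stable_hull.
pose B w := \bigcup_(v in [set v | A v `<` A w]) A v.
(* The hulls form a chain, so their union [B w] is again stable, at limit stages as well. *)
have clB w : closed (B w).
  apply: (clopenA _ _).2; apply: stable_bigcup_chain => // u v _ _.
  by have [/Amono|/Amono] := letot u v; [left|right].
have /choice[e einj] : forall w, exists e : X -> nat, {in A w &, injective e}.
  by move=> w; apply/countable_injP.
have /choice[rk rkP] : forall x, exists w, A w x /\ forall v, A v x -> le w v.
  move=> x; have [|w Awx wmin] := @well_order_min _ _ [set w | A w x] wole.
    by exists (f x); apply: sub_hull => /=; have [] := letot (f x) (f x).
  by exists w.
exists (fun n => [set x | e (rk x) x = n]); split.
  by apply/seteqP; split => // x _; exists (e (rk x) x).
move=> n; apply: discrete_subspace_isolated => x /= exn.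
have [Ax xmin] := rkP x.
exists (A (rk x) `\` B (rk x)).
  by apply: openI; [exact: (clopenA _ (sA _)).1|exact: closed_openC].
split.
  split=> // -[v /= [vx xv] Avx].
  by apply: xv; apply: Amono; exact: xmin.
move=> y [Ay nBy] eyn.
have [Ary ymin] := rkP y.
(* The inclusion of [A (rk y)] in [A (rk x)] cannot be strict, as [y] avoids [B (rk x)]. Hence the
   ranks agree, and the injectivity of [e (rk x)] on [A (rk x)] gives [y = x]. *)
have Aeq : A (rk y) = A (rk x).
  apply/seteqP; split; first by apply: Amono; exact: ymin.
  apply: contrapT => nsub; apply: nBy; exists (rk y) => //; split => //.
  by apply: Amono; exact: ymin.
have lexy : le (rk x) (rk y) by apply: xmin; rewrite Aeq.
have leyx : le (rk y) (rk x) by apply: ymin.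
have rkxy : rk y = rk x by apply: leanti; rewrite leyx.
by apply: (einj (rk x)); rewrite ?inE // -{1}rkxy eyn exn.
Qed.

(** * Points of [X] as continuous functions on [K] *)

Lemma eberlein_grothendieck_functions (R : realType) (X : topologicalType) :
  eberlein_grothendieck R X -> exists (K : topologicalType) (phi : X -> K -> R),
  [/\ compact [set: K], forall x, continuous (phi x),
      forall t, continuous (phi ^~ t) &
      forall x U, nbhs x U -> exists2 e, 0 < e &
        forall y, (forall t, `|phi x t - phi y t| < e) -> U y].
Proof.
move=> [K [cK _ [A [h [g [hK gK hc gc]]]]]].
pose phi x : {ptws K -> R} := set_val (set_val (h x)).
have phic : continuous phi.
  move=> x; apply: (@continuous_comp _ _ _ (set_val \o h)).
    by apply: continuous_comp; [exact: hc|exact: initial_continuous].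
  exact: initial_continuous.
exists K, phi; split => //.
- by move=> x; exact: (set_valP (set_val (h x))).
- move=> t x; apply: (@continuous_comp _ _ _ phi (fun f => f t)); first exact: phic.
  exact: proj_continuous.
move=> x U xU.
have : nbhs (h x) (g @^-1` U) by apply: gc; rewrite hK.
case=> _ [[_ [V oV <-] <-] /= Vx VU].
(* The uniform topology refines the pointwise one, so [V] contains a uniform ball about [phi x]. *)
have : nbhs (phi x : {uniform K -> R}) V.
  apply: (@pointwise_uniform_cvg _ _ (phi x) (nbhs (phi x : {uniform K -> R}))) => //.
  exact: open_nbhs_nbhs.
rewrite uniform_nbhs => -[E [/= entE EV]].
move: entE; rewrite -entourage_ballE => -[e /= e0 eE].
exists e => // y xy; rewrite -(hK y); apply: (VU (h y)) => /=.
apply: EV => t _ /=; apply: (eE (phi x t, phi y t)) => /=.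
by rewrite -ball_normE /=.
Qed.

(** * Finiteness and precision of grid codes *)

Lemma finite_int_itv (N : nat) : finite_set [set i : int | - N%:Z <= i < N%:Z].
Proof.
apply: (@sub_finite_set _ _ (Posz @` `I_N `|` Negz @` `I_N)).
  by move=> [n|n] /= iN; [left|right]; exists n => //=; lia.
by rewrite finite_setU; split; apply/finite_image/finite_II.
Qed.

Lemma floor_scale_close (R : realType) (m : nat) (a b : R) : (0 < m)%N ->
  Num.floor (m%:R * a) = Num.floor (m%:R * b) -> `|a - b| < m%:R^-1.
Proof.
move=> m0 eqfl; have m0' : 0 < m%:R :> R by rewrite ltr0n.
have /andP[lo hi] := floor_itv (m%:R * a).
have /andP[] := floor_itv (m%:R * b); rewrite -eqfl => lo' hi'.
rewrite -(ltr_pM2l m0') divff ?gt_eqF // -[X in X * `|_|]gtr0_norm // -normrM.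
by rewrite mulrBr ltr_norml; move: lo hi lo' hi'; rewrite intrD; lra.
Qed.

Section GridCodes.
Context (R : realType) (X : eqType) (K : topologicalType) (phi : X -> K -> R).
Implicit Types (m : nat) (s : seq X).

Definition grid_code m s (t : K) : seq int :=
  [seq Num.floor (m%:R * phi y t) | y <- s].

(** By compactness each [phi x] is bounded, so each coordinate of a code takes finitely many
    values. *)
Lemma finite_range_grid_code m s :
  compact [set: K] -> (forall x, continuous (phi x)) ->
  finite_set (range (grid_code m s)).
Proof.
move=> cK phic; elim: s => [|x s IH].
  by apply: (@sub_finite_set _ _ [set [::]]) => // _ [t _ <-].
have fx : finite_set (range (fun t => Num.floor (m%:R * phi x t))).
  have : compact (phi x @` [set: K]).
    by apply: continuous_compact => //; exact: continuous_subspaceT.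
  move=> /compact_bounded[M [_ Mb]].
  (* [Mb] applies to bounds strictly above [M], hence [M + 1]. *)
  pose N := (Num.truncn (m%:R * `|M + 1|)).+1.
  apply: sub_finite_set (finite_int_itv N) => _ [t _ <-] /=.
  have /ltr_normlP[lo hi] : `|m%:R * phi x t| < N%:R.
    rewrite normrM normr_nat (le_lt_trans _ (truncnS_gt _)) //.
    rewrite ler_wpM2l // (le_trans _ (ler_norm _)) //.
    by apply: Mb; [rewrite ltrDl|exists t].
  rewrite floor_ge_int floor_lt_int rmorphN /=; apply/andP; split => //.
  by rewrite lerNl ltW.
apply: sub_finite_set (finite_image (fun p => p.1 :: p.2) (finite_setX fx IH)).
by move=> _ [t _ <-]; exists (Num.floor (m%:R * phi x t), grid_code m s t).
Qed.

Lemma grid_code_close m s t t' y : (0 < m)%N -> y \in s ->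
  grid_code m s t = grid_code m s t' -> `|phi y t - phi y t'| < m%:R^-1.
Proof. by move=> m0 ys /eq_in_map/(_ y ys)/(floor_scale_close m0). Qed.

(* Only the set of codes of [x :: s] is remembered: if it is also that of
   [y :: s], then each [phi y t] lies in the same cell as [phi x t'] for some
   [t'] having the same code as [t] for [s]. *)
Lemma grid_code_cons_close m s x y (d : R) : (0 < m)%N ->
  (forall t t', grid_code m s t = grid_code m s t' ->
     `|phi x t - phi x t'| <= d) ->
  range (grid_code m (x :: s)) = range (grid_code m (y :: s)) ->
  forall t, `|phi x t - phi y t| <= d + m%:R^-1.
Proof.
move=> m0 xd exy t.
have : range (grid_code m (x :: s)) (grid_code m (y :: s) t).
  by rewrite exy; exists t.
case=> t' _ [/(floor_scale_close m0) xt'yt /xd xt't].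
rewrite -(subrKA (phi x t')) (le_trans (ler_normD _ _)) // lerD //.
  by rewrite distrC.
exact: ltW.
Qed.

(** Giving the code set as a list [g] makes the pairs [(m, g)] countable in number. *)
Definition grid_class m s (g : seq (seq int)) : set X :=
  [set x | range (grid_code m (x :: s)) = [set` g]].

End GridCodes.

(** * Stable sets are clopen *)

Lemma closure_pair_approx (R : realType) (X K : topologicalType)
    (phi : X -> K -> R) (A : set X) (x : X) (d : R) :
  compact [set: K] -> (forall x, continuous (phi x)) ->
  (forall t, continuous (phi ^~ t)) -> closure A x -> 0 < d ->
  exists2 s : seq X, forall y, y \in s -> A y &
    forall t t', exists2 y, y \in s &
      `|phi x t - phi y t| < d /\ `|phi x t' - phi y t'| < d.
Proof.
move=> cK phic1 phic2 clAx d0.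
have : compact [set: K * K] by rewrite -setXTT; exact: compact_setX.
have nx u : nbhs x [set y | `|phi x u - phi y u| < d].
  by move/cvgrPdist_lt: (phic2 u x); apply.
have nt y u : `|phi x u - phi y u| < d ->
    \forall t \near u, `|phi x t - phi y t| < d.
  move=> xyu; have : (fun t => `|phi x t - phi y t|) @ u --> `|phi x u - phi y u|.
    by apply: cvg_norm; apply: cvgB; exact: phic1.
  by move=> /(_ [set r | r < d]); apply; exact: lt_nbhsl.
(* Lists are directed by inclusion; the near-covering form of compactness turns lists that work near
   each pair into one list for all pairs. *)
pose F := filter_from [set s : seq X | forall y, y \in s -> A y]
  (fun s => [set s' : seq X | {subset s <= s'}]).
have FF : Filter F.
  apply: filter_from_filter; first by exists [::].
  move=> s1 s2 /= As1 As2; exists (s1 ++ s2).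
    by move=> y; rewrite mem_cat => /orP[/As1|/As2].
  by move=> s ss; split => y ys; apply: ss; rewrite mem_cat ys ?orbT.
move=> /compact_near_coveringP/(_ (seq X) F (fun s p => exists2 y, y \in s &
  `|phi x p.1 - phi y p.1| < d /\ `|phi x p.2 - phi y p.2| < d) FF) [].
  move=> [t t'] _; have [y [Ay [yt yt']]] := clAx _ (filterI (nx t) (nx t')).
  exists ([set p | `|phi x p.1 - phi y p.1| < d /\ `|phi x p.2 - phi y p.2| < d],
          [set s | y \in s]); last by move=> [p s] [/= yp ys]; exists y.
  split => /=; last first.
    exists [:: y] => [z|s] /=; first by rewrite inE => /eqP ->.
    by move=> /(_ y); rewrite inE => /(_ (eqxx _)).
  exists ([set u | `|phi x u - phi y u| < d], [set u | `|phi x u - phi y u| < d]) => //.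
  by split; exact: nt.
move=> s As sK; exists s => // t t'.
by apply: (sK s _ (t, t')).
Qed.

Lemma locally_countable_stable_clopen (R : realType) (X : topologicalType) :
  eberlein_grothendieck R X -> locally_countable X ->
  exists2 Phi : seq X -> set X, forall s, countable (Phi s) &
    forall A, stable Phi A -> open A /\ closed A.
Proof.
move=> /eberlein_grothendieck_functions[K [phi [cK phic1 phic2 unif]]] lcX.
have /choice[U UP] : forall x : X, exists U : set X, nbhs x U /\ countable U.
  by move=> x; have [U] := lcX x; exists U.
exists (fun s => \bigcup_(y in [set` s]) U y `|`
  \bigcup_(p in [set p : nat * seq (seq int) |
    countable (grid_class phi p.1 s p.2)]) grid_class phi p.1 s p.2).
  move=> s; rewrite -bigcup2E; apply: bigcup_countable => //.
  move=> [|[|?]] _ //=; apply: bigcup_countable => //.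
    exact/finite_set_countable/finite_seq.
  by move=> y _; exact: (UP y).2.
move=> A stA; split.
  rewrite openE => x Ax; apply: filterS (UP x).1 => y Uy.
  by apply: (stA x [::]) => //; left; exists x => //=; rewrite inE.
move=> x clAx.
have [Ux cU] := UP x; have [e e0 eU] := unif x _ Ux.
(* Two approximations and one grid cell bound the oscillation [osc] by [3 * d]; passing from [x] to
   a point of its class costs one more cell. *)
have [d d0 de] : exists2 d : R, 0 < d & 4 * d < e.
  by exists (e / 5); rewrite ?divr_gt0 //; lra.
have [s sA sx] := closure_pair_approx cK phic1 phic2 clAx d0.
(* [stable] speaks of nonempty lists and [s] may be empty, so [y0] is put in front. *)
have [y0 [Ay0 _]] := clAx _ filterT.
pose m := (Num.truncn d^-1).+1.
have md : m%:R^-1 < d.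
  by rewrite invf_plt ?posrE ?truncnS_gt.
have osc t t' : grid_code phi m (y0 :: s) t = grid_code phi m (y0 :: s) t' ->
    `|phi x t - phi x t'| <= 3 * d.
  move=> ett'; have [y ys [yt yt']] := sx t t'.
  have ys0 : y \in y0 :: s by rewrite in_cons ys orbT.
  have := grid_code_close (ltn0Sn _) ys0 ett'; rewrite -/m.
  by move: yt yt' md; rewrite !ltr_norml ler_norml; lra.
have /finite_seqP[g gE] := finite_range_grid_code m (x :: y0 :: s) cK phic1.
apply: (stA y0 s Ay0 sA); right; exists (m, g) => //=.
(* The class of [x] lies in the countable [U x], so it is one of those forced by [y0 :: s]. *)
apply: sub_countable cU; apply: subset_card_le => y /= yg; apply: eU => t.
apply: le_lt_trans (grid_code_cons_close _ osc _ t) _ => //; last by lra.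
by rewrite gE yg.
Qed.

Theorem theorem1p5 (R : realType) (X : topologicalType)
    (hEG : eberlein_grothendieck R X)
    (hlc : locally_countable X)
    (hsc : scattered X)
    (hcard : has_cardinality_omega1 X) :
  sigma_discrete X.
Proof.
have [Phi cPhi clopenPhi] := locally_countable_stable_clopen hEG hlc.
exact: sigma_discrete_clopen_stable cPhi clopenPhi hcard.
Qed.
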